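(* Let $\omega\in\Omega$, $y'\in Y$, and let $\mathcal{L}\subseteq[n]$ satisfy $f_\omega(\Delta(\mathcal{L},y'))=f_\omega(y')$. Then the local cut $$\theta_\omega \;\geq\; f_\omega(y')\left(1-\sum_{j\in\mathcal{L}}\ \sum_{\xi=y_j'+1}^{y_{\max}} z_{j\xi}\right)$$ is a valid Benders optimality cut on $(\omega,y')$. That is, writing $z_{j\xi}(y)=1$ if $y_j=\xi$ and $z_{j\xi}(y)=0$ otherwise, for every $y\in Y$ we have $$f_\omega(y)\;\geq\; f_\omega(y')\left(1-\sum_{j\in\mathcal{L}}\ \sum_{\xi=y_j'+1}^{y_{\max}} z_{j\xi}(y)\right),$$ and equality holds at $y=y'$.
   Context: Let $n$ be a positive integer, $[n]=\{1,\dots,n\}$, and let $y_{\min}\le y_{\max}$ be non-negative integers. The problem considered is $$\min_y\ g(y)+\sum_{\omega\in\Omega}f_\omega(y)\quad\text{subject to } y\in Y,$$ where $\Omega$ is a finite set, $Y\subseteq\{y_{\min},\dots,y_{\max}\}^n\subseteq\mathbb{Z}_+^n$ is a finite set, $g:\mathbb{Z}_+^n\to\mathbb{R}$ is a function, and for each $\omega\in\Omega$, $f_\omega:\mathbb{Z}_+^n\to\mathbb{R}_+$ is a bounded function that is non-increasing in each of the variables ($\mathbb{Z}_+$, $\mathbb{R}_+$ denote the non-negative integers and reals). In the master problem, each $f_\omega(y)$ is replaced by a continuous variable $\theta_\omega$, and binary variables $z_{j\xi}$ ($j\in[n]$, $\xi\in\{y_{\min},\dots,y_{\max}\}$) are introduced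 with $z_{j\xi}=1$ if and only if $y_j=\xi$, via the constraints $\sum_{\xi} z_{j\xi}=1$ and $\sum_\xi \xi z_{j\xi}=y_j$ for all $j\in[n]$. A Benders optimality cut on $(\omega,y')$ is an inequality $\theta_\omega\ge B(y)$ such that $B(y)\le f_\omega(y)$ for all $y\in Y$, with equality at $y=y'$. For $y\in\mathbb{Z}_+^n$ and $\mathcal{L}\subseteq[n]$, $\Delta(\mathcal{L},y)\in\mathbb{Z}_+^n$ denotes the vector obtained from $y$ by replacing $y_j$ by $y_{\max}$ for all $j\in[n]\setminus\mathcal{L}$ (and leaving $y_j$ unchanged for $j\in\mathcal{L}$). Empty sums are zero. *)

(* Defs.v *)
From mathcomp Require Import all_boot all_order all_algebra finmap reals.

Set Implicit Arguments.
Unset Strict Implicit.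
Unset Printing Implicit Defensive.

Import Order.TTheory GRing.Theory Num.Theory.
Local Open Scope ring_scope.

Definition nonincreasing_each (R : realType) (n : nat)
    (h : {ffun 'I_n -> nat} -> R) : Prop :=
  forall (j : 'I_n) (x y : {ffun 'I_n -> nat}),
    (forall k, k != j -> x k = y k) -> (x j <= y j)%N -> h y <= h x.

Definition Delta (n ymax : nat) (L : {set 'I_n}) (y : {ffun 'I_n -> nat}) :
    {ffun 'I_n -> nat} :=
  [ffun j => if j \in L then y j else ymax].

(* The values of the binary master variables z_(j, xi) determined by y.  Only
   the indices xi in {ymin, ..., ymax} are meaningful; xi ranges over nat to
   avoid a dependent index type. *)
Definition zval (R : realType) (n : nat) (y : {ffun 'I_n -> nat})
    (j : 'I_n) (xi : nat) : R :=
  (y j == xi)%:R.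

(* Right-hand side of the local cut, as an affine function of z. *)
Definition local_cut (R : realType) (n ymax : nat)
    (h : {ffun 'I_n -> nat} -> R) (y' : {ffun 'I_n -> nat}) (L : {set 'I_n})
    (z : 'I_n -> nat -> R) : R :=
  h y' * (1 - \sum_(j in L) \sum_((y' j).+1 <= xi < ymax.+1) z j xi).

(* theta >= B y is a Benders optimality cut at y' for the function h. *)
Definition optimality_cut (R : realType) (n : nat)
    (Y : {fset {ffun 'I_n -> nat}}) (h : {ffun 'I_n -> nat} -> R)
    (y' : {ffun 'I_n -> nat}) (B : {ffun 'I_n -> nat} -> R) : Prop :=
  (forall y, y \in Y -> B y <= h y) /\ B y' = h y'.

(* Main.v *)
Require Import Defs.
From mathcomp Require Import all_boot all_order all_algebra finmap reals.

Set Implicit Arguments.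
Unset Strict Implicit.
Unset Printing Implicit Defensive.

Import Order.TTheory GRing.Theory Num.Theory.
Local Open Scope ring_scope.

(** At a point [y] of the box, the inner sum over the values above [y' j] is
    [1] if [y j] exceeds [y' j] and [0] otherwise ([sum_zval]), so the cut has
    two regimes.  If [y j > y' j] for some [j] in [L], the double sum is at
    least [1] and the right-hand side is at most [0 <= f w y]
    ([local_cut_above]).  Otherwise the double sum vanishes
    ([local_cut_below]) and [y] lies below [Delta ymax L y'] in every
    coordinate: on [L] because no coordinate exceeds that of [y'], off [L]
    because [ymax] bounds the box.  Monotonicity ([nonincreasing_eachP]) then
    gives [f w y >= f w (Delta ymax L y')], which is [f w y'] by hypothesis.
    The point [y'] itself is in the second regime, whence equality there. *)

(** A chain from [x] to [y] that replaces one coordinate at a time turns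
    coordinatewise monotonicity into monotonicity for the product order. *)
Lemma nonincreasing_eachP (R : realType) (n : nat)
    (h : {ffun 'I_n -> nat} -> R) (x y : {ffun 'I_n -> nat}) :
  nonincreasing_each h -> (forall k, x k <= y k)%N -> h y <= h x.
Proof.
move=> h_noninc le_xy.
pose mix m : {ffun 'I_n -> nat} :=
  [ffun k : 'I_n => if (k < m)%N then y k else x k].
have mix0 : mix 0%N = x by apply/ffunP => k; rewrite ffunE.
have mixn : mix n = y by apply/ffunP => k; rewrite ffunE ltn_ord.
suff le_mix m : (m <= n)%N -> h (mix m) <= h x by rewrite -mixn le_mix.
elim: m => [|m IHm] lt_mn; first by rewrite mix0.
apply: le_trans (IHm (ltnW lt_mn)).
apply: (h_noninc (Ordinal lt_mn)) => [k ne_k|]; last first.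
  by rewrite !ffunE /= ltnn ltnSn le_xy.
by rewrite !ffunE ltnS [in RHS]leq_eqVlt
           -[(k == m :> nat)]/(k == Ordinal lt_mn) (negPf ne_k).
Qed.

Lemma sum_zval (R : realType) (n : nat) (y : {ffun 'I_n -> nat}) (j : 'I_n)
    (a b : nat) :
  \sum_(a <= xi < b) zval R y j xi = (a <= y j < b)%:R.
Proof.
under eq_bigr => xi _ do rewrite /zval eq_sym mulrb.
by rewrite -big_mkcond big_nat1_eq mulrb.
Qed.

Lemma local_cut_below (R : realType) (n ymax : nat)
    (h : {ffun 'I_n -> nat} -> R) (y y' : {ffun 'I_n -> nat})
    (L : {set 'I_n}) :
  (forall j, j \in L -> y j <= y' j)%N ->
  local_cut ymax h y' L (zval R y) = h y'.
Proof.
move=> le_yy'; rewrite /local_cut big1 ?subr0 ?mulr1 // => j /le_yy' le_j.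
by rewrite sum_zval ltnNge le_j.
Qed.

Lemma local_cut_above (R : realType) (n ymax : nat)
    (h : {ffun 'I_n -> nat} -> R) (y y' : {ffun 'I_n -> nat})
    (L : {set 'I_n}) (j : 'I_n) :
  0 <= h y' -> j \in L -> (y' j < y j <= ymax)%N ->
  local_cut ymax h y' L (zval R y) <= 0.
Proof.
move=> h_ge0 jL y_j; rewrite /local_cut mulr_ge0_le0 // subr_le0.
rewrite (bigD1 j) //= sum_zval ltnS y_j lerDl sumr_ge0 // => i _.
by rewrite sum_zval ler0n.
Qed.

Theorem mainTheorem2 (R : realType) (n : nat) (n_gt0 : (0 < n)%N)
    (ymin ymax : nat) (ymin_le_ymax : (ymin <= ymax)%N)
    (Omega : finType)
    (Y : {fset {ffun 'I_n -> nat}})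
    (Y_box : forall y, y \in Y -> forall j, (ymin <= y j <= ymax)%N)
    (g : {ffun 'I_n -> nat} -> R)
    (f : Omega -> {ffun 'I_n -> nat} -> R)
    (f_ge0 : forall w y, 0 <= f w y)
    (f_bounded : forall w, exists M : R, forall y, f w y <= M)
    (f_noninc : forall w, nonincreasing_each (f w))
    (w : Omega) (y' : {ffun 'I_n -> nat}) (y'_in : y' \in Y)
    (L : {set 'I_n}) (L_eq : f w (Delta ymax L y') = f w y') :
  optimality_cut Y (f w) y'
    (fun y => local_cut ymax (f w) y' L (@zval R n y)).
Proof.
split=> [y yY|]; last by rewrite local_cut_below.
have le_ymax j : (y j <= ymax)%N by case/andP: (Y_box y yY j).
have [/existsP[j /andP[jL lt_j]]|/existsPn noneL] :=
  boolP [exists j, (j \in L) && (y' j < y j)%N].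
  apply: le_trans (f_ge0 w y).
  by apply: (local_cut_above (j := j)); rewrite ?lt_j /=.
have le_L j : j \in L -> (y j <= y' j)%N.
  by move=> jL; move: (noneL j); rewrite jL /= -leqNgt.
rewrite local_cut_below // -L_eq.
apply: nonincreasing_eachP => // j; rewrite ffunE.
by case: ifP => [/le_L|].
Qed.
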